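(* Let $U,\hat U$ be Hilbert spaces, $Q:U\to\hat U$ a bounded linear operator such that $\gamma(Q)>0$, $w\in\hat U$, $u^{(0)}\in U$, and let $(u^{(n)})_{n\ge0}$ be generated by the conjugate-gradient recurrence $$u^{(n+1)}=u^{(n)}+\alpha_np^{(n)},\qquad r^{(n+1)}=r^{(n)}+\alpha_nQ^*Qp^{(n)},\qquad p^{(n+1)}=-r^{(n+1)}+\beta_np^{(n)},\qquad n\ge0,$$ where $\alpha_n:=\|r^{(n)}\|^2/\|Qp^{(n)}\|^2$ and $\beta_n:=\|r^{(n+1)}\|^2/\|r^{(n)}\|^2$, starting from $-p^{(0)}=r^{(0)}=Q^*(Qu^{(0)}-w)$. Then the error $e^{(n)}:=u^{(n)}-P_{M_{Q,w}}u^{(0)}$ satisfies $$\|e^{(n)}\|\le2\kappa\Big(1-\frac{2}{\kappa+1}\Big)^{n}\|e^{(0)}\|,\qquad n\ge0,$$ where $\kappa:=\|Q\|/\gamma(Q)$.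
   Context: $Q^*$ is the adjoint of $Q$. $M_{Q,w}:=\{u\in U:\|Qu-w\|=\inf_{v\in U}\|Qv-w\|\}$, which is nonempty for every $w$ when $\gamma(Q)>0$; $P_S$ is the orthogonal projection onto a nonempty closed affine subspace $S$. The reduced minimum modulus of $Q$ is $\gamma(Q):=\inf\{\|Qu\|:u\in(\ker Q)^\perp,\ \|u\|=1\}$; $\gamma(Q)>0$ is equivalent to $\operatorname{ran}(Q)$ being closed. The iteration is terminated as soon as $r^{(n)}=0$, in which case the sequence is regarded as constant from then on ($u^{(m)}=u^{(n)}$ for $m\ge n$). *)

(* Defs.v *)
(* MathComp with MathComp-Analysis; complex scalars R[i] come from real-closed. *)
From HB Require Import structures.
From mathcomp Require Import all_boot all_order all_algebra.
From mathcomp Require Import complex.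
From mathcomp Require Import all_classical all_reals all_analysis.

Set Implicit Arguments.
Unset Strict Implicit.
Unset Printing Implicit Defensive.

Import Order.TTheory GRing.Theory Num.Theory.
Import numFieldNormedType.Exports.

Local Open Scope classical_set_scope.
Local Open Scope ring_scope.

(* Hilbert spaces are taken over R or over C = R[i], so that statements cover
   both cases uniformly. *)
Inductive scalars := RealScalars | ComplexScalars.

Definition scalar_field (R : realType) (k : scalars) : numFieldType :=
  match k with
  | RealScalars => R
  | ComplexScalars => R[i]
  end.

Definition scalar_conj (R : realType) (k : scalars) :
    scalar_field R k -> scalar_field R k :=
  match k return scalar_field R k -> scalar_field R k with
  | RealScalars => idfun
  | ComplexScalars => fun z : R[i] => Num.conj z
  end.

Definition scalar_re (R : realType) (k : scalars) : scalar_field R k -> R :=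
  match k return scalar_field R k -> R with
  | RealScalars => fun x => x
  | ComplexScalars => fun z => complex.Re z
  end.

(* The inner product is linear in its first argument and conjugate-linear in
   the second. *)
Record hilbertSpace (R : realType) (k : scalars) := HilbertSpace {
  hilbert_sort :> completeNormedModType (scalar_field R k);
  inner : {dot hilbert_sort for @scalar_conj R k};
  inner_norm : forall x : hilbert_sort, inner x x = `|x| ^+ 2
}.

Section Operators.
Context {R : realType} {k : scalars}.

(* `|x| lives in the scalar field; rnorm x is the same number, as a real. *)
Definition rnorm {U : hilbertSpace R k} (x : U) : R := scalar_re `|x|.

Section OneSpace.
Variable U : hilbertSpace R k.

Definition orthogonal_compl (S : set U) : set U :=
  [set u | forall v, S v -> inner U u v = 0].

(* P_S x for a nonempty closed affine subspace S: the point p of S such that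
   x - p is orthogonal to the direction of S. *)
Definition affine_proj (S : set U) (x : U) : U :=
  xget 0 [set p | S p /\ forall y, S y -> inner U (x - p) (y - p) = 0].

End OneSpace.

Variables U V : hilbertSpace R k.
Implicit Type Q : {linear U -> V}.

Definition bounded_operator Q : Prop := bounded_near Q (nbhs (0 : U)).

Definition op_norm Q : R := sup [set rnorm (Q u) | u in [set u | rnorm u <= 1]].

Definition adjoint Q (v : V) : U :=
  xget 0 [set z | forall u, inner V (Q u) v = inner U u z].

Definition ker_op Q : set U := [set u | Q u = 0].

(* Extended-real infimum: the value is +oo when (ker Q)^perp = {0}, i.e. Q = 0. *)
Definition reduced_min_modulus Q : \bar R :=
  ereal_inf [set (rnorm (Q u))%:E |
    u in [set u | orthogonal_compl (ker_op Q) u /\ rnorm u = 1]].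

(* ||Q|| / gamma Q; the division is in \bar R, so this is 0 when Q = 0. *)
Definition cond_number Q : R :=
  fine ((op_norm Q)%:E / reduced_min_modulus Q)%E.

Definition least_squares_set Q (w : V) : set U :=
  [set u | rnorm (Q u - w) = inf [set rnorm (Q v - w) | v in [set: U]]].

Definition cg_alpha Q (r p : nat -> U) (n : nat) : scalar_field R k :=
  `|r n| ^+ 2 / `|Q (p n)| ^+ 2.

Definition cg_beta (r : nat -> U) (n : nat) : scalar_field R k :=
  `|r n.+1| ^+ 2 / `|r n| ^+ 2.

Record cg_sequence Q (w : V) (u r p : nat -> U) : Prop := CgSequence {
  cg_init_r : r 0%N = adjoint Q (Q (u 0%N) - w);
  cg_init_p : - p 0%N = r 0%N;
  cg_step_u : forall n, r n != 0 -> u n.+1 = u n + cg_alpha Q r p n *: p n;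
  cg_step_r : forall n, r n != 0 ->
    r n.+1 = r n + cg_alpha Q r p n *: adjoint Q (Q (p n));
  cg_step_p : forall n, r n != 0 -> p n.+1 = - r n.+1 + cg_beta r n *: p n;
  cg_stop : forall n, r n = 0 -> u n.+1 = u n /\ r n.+1 = r n
}.

End Operators.

(* Main.v *)
(** The error satisfies [Q^* Q e_n = r_n], and conjugate gradients minimise
    [|Q x|] over the affine Krylov spaces, so [|Q e_n|] is at most
    [|Q t(Q^* Q) e_0|] for any polynomial [t] of degree [n] with [t(0) = 1].
    For the rescaled Chebyshev polynomial this is estimated without spectral
    theory: the Pell identity [T_n^2 + (1 - X^2) U_(n-1)^2 = 1] shows that
    [T_n(B)] is a contraction whenever [B] is a symmetric contraction. Both
    error terms lie in the orthogonal complement of [ker Q], where [Q] is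
    bounded below by its reduced minimum modulus.

    Real and complex scalars are treated together by restricting scalars to
    the reals and working with the real part of the inner product, which is
    harmless since the coefficients of the iteration are real. The adjoint
    and the least-squares solutions both come from the symmetric Lax-Milgram
    theorem on a closed subspace. *)

Require Import Defs.
From HB Require Import structures.
From mathcomp Require Import all_boot all_order all_algebra.
From mathcomp Require Import ring lra.
From mathcomp Require Import complex.
From mathcomp Require Import all_classical all_reals all_analysis.

Set Implicit Arguments.
Unset Strict Implicit.
Unset Printing Implicit Defensive.

Import Order.TTheory GRing.Theory Num.Theory.
Import numFieldNormedType.Exports.

Local Open Scope classical_set_scope.
Local Open Scope ring_scope.

(** * Symmetric forms and Chebyshev vectors *)

(** Linearity in the second argument follows by symmetry. Definiteness is left out because the
    energy form of conjugate gradients is only semidefinite. *)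
Definition symmetric_form (R : pzRingType) (E : lmodType R) (q : E -> E -> R) :
    Prop :=
  (forall x y, q x y = q y x) /\ (forall y, scalar (q^~ y)).

Section SymmetricForm.
Variables (R : realFieldType) (E : lmodType R) (q : E -> E -> R).
Hypothesis qS : symmetric_form q.

Lemma formC x y : q x y = q y x. Proof. exact: qS.1. Qed.

Lemma formDl x y z : q (x + y) z = q x z + q y z.
Proof. by have := qS.2 z 1 x y; rewrite scale1r mul1r. Qed.

Lemma form0l z : q 0 z = 0.
Proof. by apply: (addrI (q 0 z)); rewrite -formDl !addr0. Qed.

Lemma formZl a x z : q (a *: x) z = a * q x z.
Proof. by have := qS.2 z a x 0; rewrite !addr0 form0l addr0. Qed.

Lemma formNl x z : q (- x) z = - q x z.
Proof. by rewrite -scaleN1r formZl mulN1r. Qed.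

Lemma formDr x y z : q z (x + y) = q z x + q z y.
Proof. by rewrite formC formDl !(formC _ z). Qed.

Lemma formZr a x z : q z (a *: x) = a * q z x.
Proof. by rewrite formC formZl (formC _ z). Qed.

Lemma formNr x z : q z (- x) = - q z x.
Proof. by rewrite formC formNl (formC _ z). Qed.

Lemma form0r z : q z 0 = 0.
Proof. by rewrite formC form0l. Qed.

Definition form_lin := (formDl, formDr, formNl, formNr, formZl, formZr).

Lemma form_cauchy_schwarz x y : (forall z, 0 <= q z z) ->
  q x y ^+ 2 <= q x x * q y y.
Proof.
move=> q_ge0; have [qy0|qy0] := eqVneq (q y y) 0; last first.
  have := q_ge0 (q y y *: x - q x y *: y).
  have -> : q (q y y *: x - q x y *: y) (q y y *: x - q x y *: y) =
     q y y * (q x x * q y y - q x y ^+ 2).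
    by rewrite !form_lin (formC y x); ring.
  by rewrite pmulr_rge0 ?subr_ge0// lt_neqAle eq_sym qy0 q_ge0.
rewrite qy0 mulr0; apply: contraT; rewrite -ltNge => qxy.
(* When [q y y = 0] the form is affine along [y]; this multiple makes its value
   [q x x - (q x x + 1)]. *)
have := q_ge0 (x - ((q x x + 1) / (q x y * 2)) *: y).
have -> : q (x - ((q x x + 1) / (q x y * 2)) *: y)
            (x - ((q x x + 1) / (q x y * 2)) *: y) = -1.
  rewrite !form_lin (formC y x) qy0; field.
  by apply: contraTneq qxy => ->; rewrite expr0n ltxx.
lra.
Qed.

End SymmetricForm.

Section Chebyshev.
Variable R : realFieldType.

(* With [B = d cos theta] and [c = d^2], these are [d^n cos (n theta)] and
   [d^(n-1) sin (n theta) / sin theta]: the Chebyshev polynomials of both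
   kinds in [B], homogenised so that no division by [d] occurs. *)
Fixpoint cheb (E : lmodType R) (B : E -> E) (c : R) (x : E) (n : nat) : E * E :=
  if n is m.+1 then
    let tv := cheb B c x m in
    let v := tv.1 + B tv.2 in (B v - c *: tv.2, v)
  else (x, 0).

(** Each step of the recurrence multiplies [t + h v] by [s + h]. Since [- h] is admissible too, [t]
    is the mean of [(s + h) ^+ n] and [(s - h) ^+ n]. *)
Lemma cheb_scalarE (s c h : R) n : h ^+ 2 = s ^+ 2 - c ->
  let tv := cheb (fun z : R^o => s * z) c 1 n in
  tv.1 + h * tv.2 = (s + h) ^+ n.
Proof.
move=> hE /=; elim: n => [|n IH] /=; first by rewrite mulr0 addr0 expr0.
have step (t v : R) : s * (t + s * v) - c * v + h * (t + s * v) =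
    (s + h) * (t + h * v).
  have -> : c = s ^+ 2 - h ^+ 2 by rewrite hE; ring.
  ring.
by rewrite [RHS]exprS -IH; exact: step.
Qed.

Variables (E : lmodType R) (q : E -> E -> R) (B : {linear E -> E}) (c : R).
Hypotheses (qS : symmetric_form q) (BC : forall x y, q (B x) y = q x (B y)).

(* This is [T_n^2 + (1 - X^2) U_(n-1)^2 = 1]. *)
Lemma cheb_pell x n : let tv := cheb B c x n in
  q tv.1 tv.1 + c * q tv.2 tv.2 - q (B tv.2) (B tv.2) = c ^+ n * q x x.
Proof.
elim: n => [|n IH] /=.
  by rewrite linear0 !(form0l qS) mulr0 addr0 subr0 mul1r.
rewrite exprS -mulrA -IH; set t := (cheb _ _ _ _).1; set v := (cheb _ _ _ _).2.
rewrite !linearD !(form_lin qS).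
rewrite (formC qS (B (B v)) (B t)) (formC qS (B v) t) -!BC.
rewrite (BC v t) (formC qS v (B t)); ring.
Qed.

Lemma cheb_le x n : (forall y, q (B y) (B y) <= c * q y y) ->
  q (cheb B c x n).1 (cheb B c x n).1 <= c ^+ n * q x x.
Proof. by move=> Bc; rewrite -cheb_pell -addrA lerDl subr_ge0. Qed.

(* The numerical radius of a symmetric operator bounds its norm: expand
   [q (B (y + a B y)) (y + a B y)] and [q (B (y - a B y)) (y - a B y)]
   at [a = 1 / d]. *)
Lemma form_norm_le (d : R) : 0 <= d ->
    (forall y, `|q (B y) y| <= d * q y y) ->
  forall y, q (B y) (B y) <= d ^+ 2 * q y y.
Proof.
move=> d0 Bd y.
have polar a : 2 * a * q (B y) (B y) <=
    d * (q y y + a ^+ 2 * q (B y) (B y)).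
  have := Bd (y + a *: B y); have := Bd (y - a *: B y).
  rewrite !linearD !linearN !linearZ /= !(form_lin qS) !ler_norml.
  rewrite (BC (B y) y) (formC qS (B y) y).
  move: (q (B (B y)) (B y)) (q (B y) (B y)) (q y (B y)) (q y y) => b3 b2 b1 b0.
  move=> /andP[h1 _] /andP[_ h2].
  rewrite -(ler_pM2l (ltr0n R 2)); nra.
(* For [d = 0] the choice [a = 1] already forces [q (B y) (B y) <= 0]. *)
have [d_gt0|d_le0] := ltP 0 d; last first.
  have d00 : d = 0 by apply/eqP; rewrite eq_le d_le0.
  have := polar 1; rewrite d00; lra.
have := polar d^-1; move: (q (B y) (B y)) (q y y) => b2 b0 h.
have {}h := ler_wpM2l d0 h; move: h.
have -> : d * (2 / d * b2) = 2 * b2 by field; rewrite gt_eqF.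
have -> : d * (d * (b0 + d^-1 ^+ 2 * b2)) = d ^+ 2 * b0 + b2.
  by field; rewrite gt_eqF.
lra.
Qed.

End Chebyshev.

(** * Conjugate gradients for a symmetric form *)

Section Span.
Variables (R : pzRingType) (E : lmodType R) (p : nat -> E).

(** The span of the first [n] vectors, [p n] excluded. Peeling off the last coefficient first suits
    induction along the iteration. *)
Fixpoint in_span (n : nat) (x : E) : Prop :=
  if n is m.+1 then exists a, in_span m (x - a *: p m) else x = 0.

Lemma in_span0 n : in_span n 0.
Proof. by elim: n => //= n IH; exists 0; rewrite scale0r subrr. Qed.

Lemma in_spanD n x y : in_span n x -> in_span n y -> in_span n (x + y).
Proof.
elim: n x y => [|n IH] x y /=; first by move=> -> ->; rewrite addr0.
by move=> [a xa] [b yb]; exists (a + b); rewrite scalerDl opprD addrACA;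
  exact: IH.
Qed.

Lemma in_spanZ n a x : in_span n x -> in_span n (a *: x).
Proof.
elim: n x => [|n IH] x /=; first by move=> ->; rewrite scaler0.
by move=> [b xb]; exists (a * b); rewrite -scalerA -scalerBr; exact: IH.
Qed.

Lemma in_spanN n x : in_span n x -> in_span n (- x).
Proof. by rewrite -scaleN1r; exact: in_spanZ. Qed.

Lemma in_spanB n x y : in_span n x -> in_span n y -> in_span n (x - y).
Proof. by move=> xn yn; apply: in_spanD => //; exact: in_spanN. Qed.

Lemma in_spanS n x : in_span n x -> in_span n.+1 x.
Proof. by move=> xn /=; exists 0; rewrite scale0r subr0. Qed.

Lemma in_span_le m n x : (m <= n)%N -> in_span m x -> in_span n x.
Proof.
by move=> /subnK <- xm; elim: (n - m)%N => [//|k IH]; exact: in_spanS.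
Qed.

Lemma in_span_last n : in_span n.+1 (p n).
Proof. by exists 1; rewrite scale1r subrr; exact: in_span0. Qed.

End Span.

Section ConjugateGradient.
Variables (R : realFieldType) (E : lmodType R) (ip : E -> E -> R).
Variable A : {linear E -> E}.
Hypothesis ipS : symmetric_form ip.
Hypothesis AC : forall x y, ip (A x) y = ip x (A y).
Hypothesis A_ge0 : forall x, 0 <= ip (A x) x.

(** For [A = Q^* Q] this is the inner product of [Q x] and [Q y]. *)
Let energy x y := ip (A x) y.

Lemma energyS : symmetric_form energy.
Proof.
split=> [x y|y a x z]; first by rewrite /energy AC (formC ipS).
by rewrite /energy linearP (formDl ipS) (formZl ipS).
Qed.

Variables (e p : nat -> E).
Let r n := A (e n).
Let alpha n := ip (r n) (r n) / energy (p n) (p n).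
Let beta n := ip (r n.+1) (r n.+1) / ip (r n) (r n).

(** The recurrences are used only up to a fixed [n] before which no residual vanishes, so
    termination does not enter here. *)
Variable n : nat.
Hypothesis p0 : p 0 = - r 0.
Hypothesis r_neq0 : forall m, (m < n)%N -> ip (r m) (r m) != 0.
Hypothesis eS : forall m, (m < n)%N -> e m.+1 = e m + alpha m *: p m.
Hypothesis pS : forall m, (m < n)%N -> p m.+1 = - r m.+1 + beta m *: p m.

Let rS m : (m < n)%N -> r m.+1 = r m + alpha m *: A (p m).
Proof. by move=> mn; rewrite /r eS// linearD linearZ. Qed.

Lemma residual_in_span m : (m <= n)%N -> in_span p m.+1 (r m).
Proof.
case: m => [_|m mn].
  by rewrite -[r 0]opprK -p0; apply: in_spanN; exact: in_span_last.
have -> : r m.+1 = beta m *: p m - p m.+1.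
  by rewrite pS// opprD opprK addrC subrK.
apply: in_spanB; last exact: in_span_last.
by apply/in_spanS/in_spanZ; exact: in_span_last.
Qed.

(** The claims feed each other and are proved by one induction: residuals are orthogonal to earlier
    directions, directions are conjugate, no breakdown occurs, and [A] raises the Krylov degree by
    one. *)
Lemma cg_orthogonal m : (m <= n)%N ->
  (forall z, in_span p m z -> ip (r m) z = 0 /\ energy (p m) z = 0)
  /\ ip (r m) (p m) = - ip (r m) (r m)
  /\ ((m < n)%N -> energy (p m) (p m) != 0)
  /\ (forall z, in_span p m z -> in_span p m.+1 (A z)).
Proof.
(* If the energy of [p k] vanished, Cauchy-Schwarz with [e k] would make [energy (e k) (p k)], which
   is [- ip (r k) (r k)], vanish. *)
have energy_neq0 k : (k < n)%N -> ip (r k) (p k) = - ip (r k) (r k) ->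
    energy (p k) (p k) != 0.
  move=> kn rpk; apply/eqP => pk0.
  have := form_cauchy_schwarz energyS (e k) (p k) A_ge0.
  rewrite pk0 mulr0 /energy -/(r k) rpk sqrrN => le0.
  have := r_neq0 kn.
  by rewrite -sqrf_eq0 eq_le sqr_ge0 andbT le0.
elim: m => [_|m IH mn].
  have rp0 : ip (r 0) (p 0) = - ip (r 0) (r 0) by rewrite p0 (formNr ipS).
  split; first by move=> z ->; rewrite /energy !(form0r ipS).
  split=> //; split; first by move=> n0; exact: energy_neq0.
  by move=> z ->; rewrite linear0; exact: in_span0.
have [orth [rpm [/(_ mn) pm_neq0 Aspan]]] := IH (ltnW mn).
have rm_neq0 := r_neq0 mn.
have am_neq0 : alpha m != 0 by rewrite mulf_neq0// invr_neq0.
have Apm : A (p m) = (alpha m)^-1 *: (r m.+1 - r m).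
  by rewrite rS// addrC addKr scalerA mulVf// scale1r.
have r_orth z : in_span p m.+1 z -> ip (r m.+1) z = 0.
  move=> [a /orth[rz Apz]].
  rewrite -(subrK (a *: p m) z) (formDr ipS) rS// !(formDl ipS) rz.
  rewrite !(formZl ipS) -/(energy _ _) Apz !(formZr ipS) rpm -/(energy _ _).
  by rewrite /alpha; field.
have Aspan' z : in_span p m.+1 z -> in_span p m.+2 (A z).
  move=> [a /Aspan Az].
  have -> : A z = A (z - a *: p m) + a *: A (p m).
    by rewrite -linearZZ -linearD subrK.
  apply: in_spanD; first exact: in_spanS.
  rewrite Apm scalerA; apply/in_spanZ/in_spanB; first exact: residual_in_span.
  by apply: in_spanS; apply: residual_in_span; exact: ltnW.
have rpSm : ip (r m.+1) (p m.+1) = - ip (r m.+1) (r m.+1).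
  rewrite {1}pS// (formDr ipS) (formNr ipS) (formZr ipS).
  by rewrite (r_orth (p m)) ?mulr0 ?addr0//; exact: in_span_last.
split=> [z zm|]; last by split=> //; split=> // n_gt; exact: energy_neq0.
split; first exact: r_orth.
(* Conjugacy to the earlier part of [z] holds since [A] maps it into a span orthogonal to [r m.+1].
   Along [p m], the value of [beta m] cancels the remaining terms. *)
case: zm => a zm; rewrite -(subrK (a *: p m) z) (formDr energyS).
rewrite (formZr energyS) pS// !(formDl energyS) !(formNl energyS).
rewrite !(formZl energyS) (orth _ zm).2 {1}/energy AC (r_orth _ (Aspan _ zm)).
rewrite {1}/energy AC Apm (formZr ipS) (formDr ipS) (formNr ipS).
rewrite (r_orth (r m)); last by apply: residual_in_span; exact: ltnW.
by rewrite /alpha /beta; field; rewrite rm_neq0.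
Qed.

Lemma cg_error_in_span m : (m <= n)%N -> in_span p m (e m - e 0).
Proof.
elim: m => [_|m IH mn]; first by rewrite /= subrr.
by exists (alpha m); rewrite eS// addrAC addrK; apply: IH; exact: ltnW.
Qed.

(** Pythagoras: [t - a *: e n] lies in the span, hence is energy-orthogonal to [e n]. The factor [a]
    stands for the value at zero of the competing polynomial, so no normalisation is required. *)
Lemma cg_optimal (t : E) (a : R) : in_span p n (t - a *: e 0) ->
  a ^+ 2 * energy (e n) (e n) <= energy t t.
Proof.
move=> tn; have [orth _] := cg_orthogonal (leqnn n).
have d_span : in_span p n (t - a *: e n).
  have -> : t - a *: e n = (t - a *: e 0) - a *: (e n - e 0).
    by rewrite scalerBr opprB addrA subrK.
  by apply: in_spanB => //; apply: in_spanZ; exact: cg_error_in_span.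
have d_orth : energy (e n) (t - a *: e n) = 0 by rewrite /energy (orth _ _).1.
rewrite -(subrK (a *: e n) t); move: (t - a *: e n) d_orth => d d_orth.
rewrite (formDl energyS) !(formDr energyS) !(formZl energyS) !(formZr energyS).
rewrite (formC energyS d (e n)) d_orth !mulr0 add0r addr0 mulrA -expr2 lerDr.
exact: A_ge0.
Qed.

(** The scalars [tau] are the constant terms in [A], obtained by replacing [B] with [s]. The second
    component has degree one less than the first, so its next value still fits in the span of size
    [m]; this third claim carries the induction. *)
Lemma cheb_in_span (s c : R) (B : {linear E -> E}) m :
    (forall x, B x = s *: x - 2 *: A x) -> (m <= n)%N ->
  let tau := cheb (fun z : R^o => s * z) c 1 in
  let tv := cheb B c (e 0) in
  [/\ in_span p m ((tv m).1 - (tau m).1 *: e 0),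
      in_span p m ((tv m).2 - (tau m).2 *: e 0) &
      in_span p m ((tv m.+1).2 - (tau m.+1).2 *: e 0)].
Proof.
move=> BE + tau tv; elim: m => [_|m IH mn].
  by rewrite /= linear0 mulr0 !addr0 scale1r scale0r subr0 subrr.
have [tm vm vSm] := IH (ltnW mn).
have BS (x : E) (a : R) : in_span p m (x - a *: e 0) ->
    in_span p m.+1 (B x - (s * a) *: e 0).
  move=> xm.
  have -> : B x - (s * a) *: e 0 = B (x - a *: e 0) - (2 * a) *: A (e 0).
    rewrite linearB [B (a *: _)]linearZ /= (BE (e 0)) -addrA -opprD.
    congr (_ - _).
    by rewrite scalerBr !scalerA (mulrC a s) (mulrC a 2) subrK.
  have [_ [_ [_ Aspan]]] := cg_orthogonal (ltnW mn).
  rewrite BE; apply: in_spanB; last first.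
    apply/in_spanZ/(@in_span_le _ _ _ 1) => //.
    exact: (residual_in_span (leq0n n)).
  apply: in_spanB; first by apply/in_spanS/in_spanZ.
  by apply/in_spanZ/Aspan.
have tSm : in_span p m.+1 ((tv m.+1).1 - (tau m.+1).1 *: e 0).
  have -> : (tv m.+1).1 - (tau m.+1).1 *: e 0 =
      (B (tv m.+1).2 - (s * (tau m.+1).2) *: e 0)
      - c *: ((tv m).2 - (tau m).2 *: e 0).
    rewrite /tv /tau /= [c *: (cheb _ _ _ _).2]/GRing.scale /=.
    by rewrite scalerBr scalerA scalerBl !opprD !opprK addrACA.
  by apply: in_spanB; [exact: BS | apply/in_spanS/in_spanZ].
split; [by [] | exact: in_spanS |].
have -> : (tv m.+2).2 - (tau m.+2).2 *: e 0 =
    ((tv m.+1).1 - (tau m.+1).1 *: e 0)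
    + (B (tv m.+1).2 - (s * (tau m.+1).2) *: e 0).
  by rewrite addrACA -opprD -scalerDl.
by apply: in_spanD => //; exact: BS.
Qed.

(** The map [B = s - 2 A] takes the interval from [g ^+ 2] to [L ^+ 2] onto the one from [- d] to
    [d], and its value at [A = 0] is [s]. *)
Lemma cg_energy_le (L g : R) : 0 < g -> g <= L ->
    (forall x, g ^+ 2 * energy x x <= energy (A x) x <= L ^+ 2 * energy x x) ->
  (L + g) ^+ n ^+ 2 * energy (e n) (e n)
    <= 4 * (L - g) ^+ n ^+ 2 * energy (e 0) (e 0).
Proof.
move=> g0 gL bounds.
have L0 : 0 < L by apply: lt_le_trans gL.
pose s := L ^+ 2 + g ^+ 2; pose d := L ^+ 2 - g ^+ 2.
have d0 : 0 <= d by rewrite subr_ge0 lerXn2r ?nnegrE// ltW.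
pose B : {linear E -> E} := (s \*: idfun \- 2 \*: A).
have BE x : B x = s *: x - 2 *: A x by [].
have BC x y : energy (B x) y = energy x (B y).
  have BA z : A (B z) = s *: A z - 2 *: A (A z) by rewrite BE linearB !linearZZ.
  rewrite /energy BA BE (formDl ipS) (formDr ipS).
  by rewrite !(formNl ipS, formNr ipS, formZl ipS, formZr ipS) !AC.
have B_le y : energy (B y) (B y) <= d ^+ 2 * energy y y.
  apply: (form_norm_le energyS) => // x.
  have := bounds x.
  rewrite BE (formDl energyS) (formNl energyS) !(formZl energyS).
  by rewrite ler_norml /s /d; move: (energy x x) (energy (A x) x) => ? ? ?; lra.
have [t_span _ _] := cheb_in_span (d ^+ 2) BE (leqnn n).
have := le_trans (cg_optimal t_span) (cheb_le energyS BC (e 0) n B_le).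
set tau := (cheb _ _ _ n).1.
(* Here [s ^+ 2 - d ^+ 2] is the square of [2 * L * g], and [s] plus or minus [2 * L * g] is the
   square of [L + g] or [L - g]. *)
have tau_ge : (L + g) ^+ n ^+ 2 <= 2 * tau.
  have := @cheb_scalarE R s (d ^+ 2) (2 * L * g) n.
  have := @cheb_scalarE R s (d ^+ 2) (- (2 * L * g)) n.
  have h2 : (2 * L * g) ^+ 2 = s ^+ 2 - d ^+ 2 by rewrite /s /d; ring.
  rewrite sqrrN /= => /(_ h2) tau_minus /(_ h2) tau_plus.
  have -> : (L + g) ^+ n ^+ 2 = (s + 2 * L * g) ^+ n.
    by rewrite exprAC; congr (_ ^+ n); rewrite /s; ring.
  rewrite -tau_plus.
  have : 0 <= (s + - (2 * L * g)) ^+ n.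
    have -> : s + - (2 * L * g) = (L - g) ^+ 2 by rewrite /s; ring.
    by rewrite exprn_ge0// sqr_ge0.
  rewrite -tau_minus /tau.
  by move: (cheb _ _ _ n) => [t v] /=; lra.
have dE : d ^+ 2 ^+ n = (L - g) ^+ n ^+ 2 * (L + g) ^+ n ^+ 2.
  have -> : d = (L - g) * (L + g) by rewrite /d; ring.
  by rewrite exprAC !exprMn.
rewrite dE.
have := A_ge0 (e n); rewrite -/(energy _ _).
have X0 : 0 < (L + g) ^+ n ^+ 2 by rewrite !exprn_gt0// addr_gt0.
move: tau_ge X0; move: ((L + g) ^+ n ^+ 2) ((L - g) ^+ n ^+ 2) => X Y.
move: tau (energy (e n) _) (energy (e 0) _) => tau en e0 tX X0 en0 h.
(* The chain is [X ^+ 2 * en <= 4 * tau ^+ 2 * en <= 4 * X * Y * e0]. *)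
rewrite -(ler_pM2l X0).
have : X ^+ 2 * en <= (2 * tau) ^+ 2 * en.
  by rewrite ler_wpM2r// lerXn2r// nnegrE ?ltW// (lt_le_trans X0).
nra.
Qed.

End ConjugateGradient.

(** * Restriction of scalars *)

Section Scalars.
Variables (R : realType) (k : scalars).
Local Notation K := (scalar_field R k).

Definition real_scalar : R -> K :=
  match k return R -> scalar_field R k with
  | RealScalars => fun x => x
  | ComplexScalars => fun x => x%:C%C
  end.

Lemma real_scalarD a b : real_scalar (a + b) = real_scalar a + real_scalar b.
Proof. by rewrite /real_scalar; case: k => //=; rewrite rmorphD. Qed.

Lemma real_scalarM a b : real_scalar (a * b) = real_scalar a * real_scalar b.
Proof. by rewrite /real_scalar; case: k => //=; rewrite rmorphM. Qed.

Lemma real_scalar1 : real_scalar 1 = 1.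
Proof. by rewrite /real_scalar; case: k. Qed.

Lemma real_scalar0 : real_scalar 0 = 0.
Proof. by rewrite /real_scalar; case: k. Qed.

Lemma real_scalarV a : real_scalar a^-1 = (real_scalar a)^-1.
Proof. by rewrite /real_scalar; case: k => //=; rewrite fmorphV. Qed.

Lemma real_scalarX a n : real_scalar (a ^+ n) = real_scalar a ^+ n.
Proof. by rewrite /real_scalar; case: k => //=; rewrite rmorphXn. Qed.

Lemma ler_real_scalar a b : (real_scalar a <= real_scalar b) = (a <= b).
Proof. by rewrite /real_scalar; case: k => //=; rewrite lecR. Qed.

Lemma ltr_real_scalar a b : (real_scalar a < real_scalar b) = (a < b).
Proof. by rewrite /real_scalar; case: k => //=; rewrite ltcR. Qed.

Lemma scalar_reK (z : K) : z \is Num.real -> real_scalar (scalar_re z) = z.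
Proof.
by rewrite /real_scalar /scalar_re; case: k z => //= z; exact: RRe_real.
Qed.

Lemma real_scalarK a : scalar_re (real_scalar a) = a.
Proof. by rewrite /real_scalar /scalar_re; case: k. Qed.

Lemma scalar_reD (z w : K) : scalar_re (z + w) = scalar_re z + scalar_re w.
Proof. by rewrite /scalar_re; move: z w; case: k => //= -[a b] [c d]. Qed.

Lemma scalar_reB (z w : K) : scalar_re (z - w) = scalar_re z - scalar_re w.
Proof. by rewrite /scalar_re; move: z w; case: k => //= -[a b] [c d]. Qed.

Lemma scalar_re_scale a (z : K) :
  scalar_re (real_scalar a * z) = a * scalar_re z.
Proof.
rewrite /scalar_re /real_scalar; move: z; case: k => //= -[b c] /=.
by rewrite mul0r subr0.
Qed.

Lemma scalar_re_conj (z : K) : scalar_re (scalar_conj z) = scalar_re z.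
Proof.
rewrite /scalar_re /scalar_conj; move: z; case: k => //= -[b c] /=.
done.
Qed.

Lemma real_scalar_conj a : scalar_conj (real_scalar a) = real_scalar a.
Proof.
rewrite /scalar_conj /real_scalar; case: k => //=.
by apply: conj_Creal; rewrite complex_real.
Qed.

Lemma scalar_conj_mulE (z : K) : z * scalar_conj z = `|z| ^+ 2.
Proof.
rewrite /scalar_conj; move: z; case: k => /= z.
  by rewrite real_normK ?num_real// expr2.
by rewrite -normCK.
Qed.

End Scalars.

(** An alias of the carrier, so that a real module structure can coexist with the original one. *)
Definition realified (R : realType) (k : scalars) (U : hilbertSpace R k) :
  Type := U.

Section Realified.
Variables (R : realType) (k : scalars) (U : hilbertSpace R k).

HB.instance Definition _ := GRing.Zmodule.on (realified U).

Let scale (a : R) (x : realified U) : realified U := real_scalar k a *: (x : U).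

Let scaleA a b x : scale a (scale b x) = scale (a * b) x.
Proof. by rewrite /scale scalerA real_scalarM. Qed.

Let scale1 : left_id 1 scale.
Proof. by move=> x; rewrite /scale real_scalar1 scale1r. Qed.

Let scaleDr : right_distributive scale +%R.
Proof. by move=> a x y; rewrite /scale scalerDr. Qed.

Let scaleDl x : {morph scale^~ x : a b / a + b}.
Proof. by move=> a b; rewrite /scale real_scalarD scalerDl. Qed.

HB.instance Definition _ := GRing.Zmodule_isLmodule.Build R (realified U)
  scaleA scale1 scaleDr scaleDl.

Lemma realified_scaleE (a : R) (x : U) :
  a *: (x : realified U) = real_scalar k a *: x :> U.
Proof. by []. Qed.

Definition rip (x y : realified U) : R := scalar_re (inner U x y).

Lemma innerC (x y : U) : inner U x y = scalar_conj (inner U y x).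
Proof. by rewrite [LHS]hermitian_subproof expr0 mul1r. Qed.

Lemma innerPl (a : scalar_field R k) (x y z : U) :
  inner U (a *: x + y) z = a * inner U x z + inner U y z.
Proof. by rewrite linearPl. Qed.

Lemma ripS : symmetric_form rip.
Proof.
split=> [x y|y a x z]; rewrite /rip.
  by rewrite innerC scalar_re_conj.
by rewrite innerPl scalar_reD scalar_re_scale.
Qed.

Lemma real_scalar_rnorm (x : U) : real_scalar k (rnorm x) = `|x|.
Proof. by rewrite scalar_reK// ger0_real. Qed.

Lemma rip_norm (x : U) : rip x x = rnorm x ^+ 2.
Proof.
rewrite /rip inner_norm -real_scalar_rnorm expr2.
by rewrite -real_scalarM real_scalarK expr2.
Qed.

Lemma rnorm_ge0 (x : U) : 0 <= rnorm x.
Proof. by rewrite -(ler_real_scalar k) real_scalar0 real_scalar_rnorm. Qed.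

Lemma rip_ge0 (x : U) : 0 <= rip x x.
Proof. by rewrite rip_norm sqr_ge0. Qed.

Lemma rnorm0 : rnorm (0 : U) = 0.
Proof. by rewrite /rnorm normr0 -(real_scalar0 R k) real_scalarK. Qed.

Lemma rnorm_eq0 (x : U) : (rnorm x == 0) = (x == 0).
Proof.
apply/eqP/eqP => [x0|->]; last exact: rnorm0.
by apply/eqP; rewrite -normr_eq0 -real_scalar_rnorm x0 real_scalar0.
Qed.

Lemma rnorm_gt0 (x : U) : (0 < rnorm x) = (x != 0).
Proof. by rewrite lt_neqAle eq_sym rnorm_eq0 rnorm_ge0 andbT. Qed.

Lemma rip_eq0 (x : U) : (rip x x == 0) = (x == 0).
Proof. by rewrite rip_norm sqrf_eq0 rnorm_eq0. Qed.

Lemma normr_rip_le (x y : U) : `|rip x y| <= rnorm x * rnorm y.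
Proof.
have := form_cauchy_schwarz ripS x y rip_ge0.
rewrite !rip_norm -exprMn => le2.
rewrite -(@ler_pXn2r _ 2)// ?nnegrE ?mulr_ge0 ?rnorm_ge0//.
by rewrite real_normK ?num_real.
Qed.

Lemma rnormZ (a : R) (x : U) : rnorm (a *: (x : realified U)) = `|a| * rnorm x.
Proof.
apply/eqP; rewrite -(@eqrXn2 _ 2)// ?mulr_ge0// ?rnorm_ge0//.
rewrite exprMn -!rip_norm (formZl ripS) (formZr ripS) mulrA.
by rewrite real_normK ?num_real.
Qed.

Lemma rip_nondegenerate (x y : U) : (forall z, rip z x = rip z y) -> x = y.
Proof.
move=> xy; apply/eqP; rewrite -subr_eq0 -rip_eq0.
by rewrite (formDr ripS) (formNr ripS) xy subrr.
Qed.

(** Taking for [a] the conjugate of [inner U x y] turns the real part into a squared modulus. *)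
Lemma rip_inner_eq0 (x y : U) :
  (forall a : scalar_field R k, rip (a *: x) y = 0) -> inner U x y = 0.
Proof.
move=> /(_ (scalar_conj (inner U x y))); rewrite /rip.
rewrite -[_ *: x]addr0 innerPl mulrC scalar_conj_mulE.
have -> : inner U 0 y = 0 by exact: linear0l.
rewrite addr0 => /(congr1 (real_scalar k)).
rewrite scalar_reK ?real_scalar0; last by rewrite ger0_real// exprn_ge0.
by move/eqP; rewrite expf_eq0 normr_eq0 => /eqP.
Qed.

(** Stated with real radii, whereas the topology of [U] has radii in the scalar field. *)
Definition rnorm_cvg (x : nat -> U) (l : U) : Prop :=
  forall eps : R, 0 < eps -> exists N, forall i,
    (N <= i)%N -> rnorm (x i - l) < eps.

Lemma rnorm_complete (x : nat -> U) :
  (forall eps : R, 0 < eps -> exists N, forall i j,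
    (N <= i)%N -> (N <= j)%N -> rnorm (x i - x j) < eps) ->
  exists l, rnorm_cvg x l.
Proof.
move=> x_cauchy.
have : cvg (x @ \oo).
  apply: cauchy_cvg; apply: cauchy_exP => eps eps0.
  have epsE := scalar_reK (gtr0_real eps0).
  have [|N xN] := x_cauchy (scalar_re eps).
    by rewrite -(ltr_real_scalar k) real_scalar0 epsE.
  exists (x N); exists N => // i Ni; rewrite -ball_normE /=.
  by rewrite -real_scalar_rnorm -epsE ltr_real_scalar xN.
move=> /cvg_ex[l /cvgrPdist_lt xl]; exists l => eps eps0.
have [|N _ Nl] := xl (real_scalar k eps).
  by rewrite -(real_scalar0 R k) ltr_real_scalar.
exists N => i /Nl.
by rewrite distrC -real_scalar_rnorm ltr_real_scalar.
Qed.

End Realified.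

(** * The symmetric Lax-Milgram theorem *)

Section LaxMilgram.
Variables (R : realType) (k : scalars) (U : hilbertSpace R k).
Variables (S : set (realified U)) (q : realified U -> realified U -> R).
Variables (f : {scalar realified U}) (g C M : R).
Hypothesis qS : symmetric_form q.
Hypothesis S0 : S 0.
Hypothesis SP : forall a x y, S x -> S y -> S (a *: x + y).
Hypothesis S_closed : forall (x : nat -> U) l,
  (forall i, S (x i)) -> rnorm_cvg x l -> S l.
Hypotheses (g0 : 0 < g) (C0 : 0 <= C).
Hypothesis q_coercive : forall x : U, S x -> g * rnorm x ^+ 2 <= q x x.
Hypothesis q_bounded : forall x y : U, `|q x y| <= C * rnorm x * rnorm y.
Hypothesis f_bounded : forall x : U, f x <= M * rnorm x.

Let J x := q x x - 2 * f x.

Let J_shift t (x h : realified U) :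
  J (t *: h + x) = J x + 2 * t * (q x h - f h) + t ^+ 2 * q h h.
Proof.
rewrite /J linearP /= !(form_lin qS) (formC qS h x); ring.
Qed.

Let J_lbound : has_lbound [set J x | x in S].
Proof.
(* This is the minimum over [a] of [g * a ^+ 2 - 2 * M * a]. *)
exists (- (M ^+ 2 / g)) => _ [x Sx <-]; rewrite /J.
have := q_coercive Sx; have := f_bounded x.
move: (rnorm (x : U)) (q x x) (f x) => a b c h1 h2.
rewrite -(ler_pM2l g0) mulrN mulrCA divff ?gt_eqF// mulr1.
have := sqr_ge0 (g * a - M); have := ler_wpM2l (ltW g0) h1.
have := ler_wpM2l (ltW g0) h2; nra.
Qed.

Let m := inf [set J x | x in S].

Let J_ge x : S x -> m <= J x.
Proof. by move=> Sx; apply: ge_inf => //; exists x. Qed.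

(* The parallelogram identity: a minimising sequence of [J] is Cauchy. *)
Let J_dist x y : S x -> S y ->
  g * rnorm (x - y : U) ^+ 2 <= 2 * (J x - m) + 2 * (J y - m).
Proof.
move=> Sx Sy.
have Sxy : S ((-1) *: y + x) by exact: SP.
have Shalf : S (2^-1 *: ((-1) *: y + x) + y) by exact: SP.
have fz : f (2^-1 *: ((-1) *: y + x) + y) = (f x + f y) / 2.
  by rewrite !linearP /=; field.
have := J_ge Shalf; have := q_coercive Sxy.
rewrite /J fz scaleN1r (addrC (- y) x) !(form_lin qS) (formC qS y x).
lra.
Qed.

(** The solution is the limit [l] of a minimising sequence of [J]. If the equation failed at some
    [h], a step along [h] from a late term of the sequence would bring [J] below its infimum. *)
Lemma symmetric_lax_milgram : exists2 y, S y & forall x, S x -> q y x = f x.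
Proof.
have minseq i : exists x, S x /\ J x < m + i.+1%:R^-1.
  have [||_ [x Sx <-] Jx] := @inf_adherent R [set J x | x in S] i.+1%:R^-1.
  - by rewrite invr_gt0 ltr0n.
  - by split=> //; exists (J 0), 0.
  - by exists x.
have [x xP] := choice minseq.
have Sx i : S (x i) by have [] := xP i.
have Jx i : J (x i) - m < i.+1%:R^-1.
  by rewrite ltrBlDl; have [] := xP i.
have inv_small (eps : R) : 0 < eps ->
    exists N, forall i, (N <= i)%N -> i.+1%:R^-1 < eps.
  move=> eps0; have [N _ NP] := near_infty_natSinv_lt (PosNum eps0).
  by exists N.
have [|l xl] := @rnorm_complete R k U x.
  move=> eps eps0.
  have [|N NP] := inv_small (g * eps ^+ 2 / 4).
    by rewrite divr_gt0// mulr_gt0// exprn_gt0.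
  exists N => i j Ni Nj.
  rewrite -(@ltr_pXn2r _ 2)// ?nnegrE ?rnorm_ge0// ?ltW// -(ltr_pM2l g0).
  apply: le_lt_trans (J_dist (Sx i) (Sx j)) _.
  have := Jx i; have := Jx j; have := NP i Ni; have := NP j Nj.
  by move: (i.+1%:R^-1) (j.+1%:R^-1) (g * _) => a b c; lra.
have Sl := S_closed Sx xl; exists l => // h Sh; apply: contrapT => /eqP.
rewrite -subr_eq0; set D := q l h - f h => D_neq0.
have D0 : 0 < `|D| by rewrite normr_gt0.
have qhh : 0 <= q h h.
  by apply: le_trans (q_coercive Sh); rewrite mulr_ge0 ?sqr_ge0// ltW.
(* The first threshold keeps the slope at [x i] within a quarter of [D]. The second bounds the
   excess of [J (x i)] by half of [D ^+ 2 / (q h h + 1)], a decrease which the step achieves. Each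
   [+ 1] keeps a denominator positive. *)
have [|N1 N1P] := xl (`|D| / (4 * (C * rnorm (h : U) + 1))).
  by rewrite divr_gt0// mulr_gt0// ltr_wpDl// mulr_ge0// rnorm_ge0.
have [|N2 N2P] := inv_small (D ^+ 2 / (2 * (q h h + 1))).
  by rewrite divr_gt0 ?exprn_even_gt0// mulr_gt0// ltr_wpDl.
pose i := maxn N1 N2.
have {}N1P := N1P i (leq_maxl _ _); have {}N2P := N2P i (leq_maxr _ _).
have Di : `|q (x i) h - f h - D| <= `|D| / 4.
  have -> : q (x i) h - f h - D = q (x i - l) h.
    by rewrite /D (formDl qS) (formNl qS); ring.
  apply: le_trans (q_bounded _ _) _.
  have C1 : 0 < C * rnorm (h : U) + 1.
    by rewrite ltr_wpDl// mulr_ge0// rnorm_ge0.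
  move: N1P; rewrite ltr_pdivlMr ?mulr_gt0//.
  have := rnorm_ge0 (x i - l : U).
  rewrite mulrAC; move: (C * rnorm (h : U)) (rnorm (x i - l : U)) => c a.
  move: `|D| => d. lra.
have DDx : 3 / 4 * D ^+ 2 <= D * (q (x i) h - f h).
  have : `|D * (q (x i) h - f h - D)| <= D ^+ 2 / 4.
    rewrite normrM -[D ^+ 2]real_normK ?num_real// expr2 -mulrA.
    by rewrite ler_wpM2l// normr_ge0.
  by rewrite ler_norml => /andP[+ _]; lra.
have := J_ge (SP (- (D / (q h h + 1))) Sh (Sx i)).
rewrite J_shift.
have c0 : 0 < q h h + 1 by rewrite ltr_wpDl.
have := lt_trans (Jx i) N2P; move: DDx.
set c := q h h + 1; have -> : q h h = c - 1 by rewrite addrK.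
have -> : D = D / c * c by rewrite divfK// gt_eqF.
rewrite mulfK ?gt_eqF//; move: (D / c) (q (x i) h - f h) (J (x i)) => a Dx j.
have -> : (a * c) ^+ 2 / (2 * c) = a ^+ 2 * c / 2 by field; rewrite gt_eqF.
have -> : 3 / 4 * (a * c) ^+ 2 = c * (3 / 4 * a ^+ 2 * c) by ring.
have -> : a * c * Dx = c * (a * Dx) by ring.
rewrite ler_pM2l//; have := sqr_ge0 a; nra.
Qed.

End LaxMilgram.

(** * Bounded operators, adjoints and least squares *)

Section Operator.
Variables (R : realType) (k : scalars) (U V : hilbertSpace R k).
Variable Q : {linear U -> V}.
Hypothesis boundedQ : bounded_operator Q.

Let QS : linear (Q : realified U -> realified V).
Proof. by move=> a x y; rewrite !realified_scaleE linearP. Qed.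

(** The real supremum in [op_norm] is meaningful only with such a bound. *)
Lemma op_norm_has_ubound :
  has_ubound [set rnorm (Q u) | u in [set u | rnorm u <= 1]].
Proof.
have [M M_gt0 MP] : exists2 M : scalar_field R k, 0 < M &
    forall x : U, `|Q x| <= M * `|x|.
  by have /linear_boundedP/pinfty_ex_gt0[M M0 MP] := boundedQ; exists M.
exists (scalar_re M) => _ [x /= x1 <-].
have ME := scalar_reK (gtr0_real M_gt0).
have M0 : 0 <= scalar_re M.
  by rewrite -(ler_real_scalar k) real_scalar0 ME ltW.
apply: le_trans (_ : scalar_re M * rnorm x <= _).
  by rewrite -(ler_real_scalar k) real_scalarM ME !real_scalar_rnorm.
by rewrite ler_piMr.
Qed.

Lemma rnorm_op_le (x : U) : rnorm (Q x) <= op_norm Q * rnorm x.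
Proof.
have [->|x0] := eqVneq x 0.
  by rewrite linear0 !rnorm0 mulr0.
have nx0 : 0 < rnorm x by rewrite rnorm_gt0.
rewrite -ler_pdivrMr// mulrC -[(rnorm x)^-1]ger0_norm ?invr_ge0 ?rnorm_ge0//.
rewrite -rnormZ realified_scaleE -linearZZ.
apply: ub_le_sup; first exact: op_norm_has_ubound.
exists (real_scalar k (rnorm x)^-1 *: x) => //=.
rewrite -realified_scaleE rnormZ ger0_norm ?invr_ge0 ?rnorm_ge0//.
by rewrite mulVf// gt_eqF.
Qed.

Lemma op_norm_ge0 : 0 <= op_norm Q.
Proof.
apply: le_trans (rnorm_ge0 (Q 0)) _; apply: ub_le_sup.
  exact: op_norm_has_ubound.
by exists 0 => //=; rewrite rnorm0.
Qed.

(** Lax-Milgram for the inner product itself is the Riesz theorem; it shows that the choice in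
    [adjoint] is not the default value. *)
Lemma adjointP (u : U) (v : V) : inner V (Q u) v = inner U u (adjoint Q v).
Proof.
suff : exists z, forall u, inner V (Q u) v = inner U u z.
  by move=> /(xgetPex 0)/(_ u).
have fS : scalar (fun x : realified U => rip (Q x) v).
  by move=> a x y; rewrite QS (formDl (ripS V)) (formZl (ripS V)).
pose f : {scalar realified U} := HB.pack (fun x : realified U => rip (Q x) v)
  (GRing.isLinear.Build R (realified U) R _ _ fS).
have [||||||||z _ zP] := @symmetric_lax_milgram R k U setT (@rip R k U) f
   1 1 (op_norm Q * rnorm v) (ripS U) => //.
- by move=> x _; rewrite mul1r rip_norm.
- by move=> x y; rewrite mul1r normr_rip_le.
- move=> x /=; apply: le_trans (ler_norm _) _.
  apply: le_trans (normr_rip_le _ _) _.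
  by rewrite mulrAC ler_wpM2r ?rnorm_ge0// rnorm_op_le.
exists z => x; apply/eqP; rewrite -subr_eq0; apply/eqP.
set D := (X in X = _).
(* So far only real parts agree; replacing [x] by [a *: x] makes the real part of the discrepancy
   the squared modulus of [D]. *)
pose a := scalar_conj D.
have DZ : inner V (Q (a *: x)) v - inner U (a *: x) z = a * D.
  rewrite linearZZ -[a *: Q x]addr0 -[a *: x]addr0 !innerPl.
  have -> : inner V 0 v = 0 by exact: linear0l.
  have -> : inner U 0 z = 0 by exact: linear0l.
  by rewrite !addr0 -mulrBr.
have : scalar_re (a * D) = 0.
  rewrite -DZ scalar_reB -/(rip _ _) -/(rip (a *: x) z).
  by rewrite (formC (ripS U)) zP// subrr.
rewrite mulrC scalar_conj_mulE => /(congr1 (real_scalar k)).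
rewrite scalar_reK ?real_scalar0; last by rewrite ger0_real// exprn_ge0.
by move/eqP; rewrite expf_eq0 normr_eq0 => /eqP.
Qed.

Lemma rip_adjoint (u : U) (v : V) : rip (Q u) v = rip u (adjoint Q v).
Proof. by rewrite /rip adjointP. Qed.

Lemma adjoint_linear : linear (adjoint Q : realified V -> realified U).
Proof.
move=> a x y; apply: rip_nondegenerate => z.
rewrite -rip_adjoint !(formDr (ripS _)) !(formZr (ripS _)).
by rewrite !rip_adjoint.
Qed.

Lemma adjointB (x y : V) : adjoint Q (x - y) = adjoint Q x - adjoint Q y.
Proof.
have := adjoint_linear (-1) y x; rewrite !scaleN1r => AyDx.
by rewrite addrC AyDx addrC.
Qed.

Lemma rnorm_adjoint_le (v : V) : rnorm (adjoint Q v) <= op_norm Q * rnorm v.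
Proof.
have [->|x0] := eqVneq (adjoint Q v) 0.
  by rewrite rnorm0 mulr_ge0 ?rnorm_ge0 ?op_norm_ge0.
have nx0 : 0 < rnorm (adjoint Q v).
  by rewrite rnorm_gt0.
rewrite -(ler_pM2l nx0) -expr2 -rip_norm -rip_adjoint.
apply: le_trans (ler_norm _) _; apply: le_trans (normr_rip_le _ _) _.
by rewrite mulrA ler_wpM2r ?rnorm_ge0// mulrC rnorm_op_le.
Qed.

Let N := orthogonal_compl (ker_op Q).

(** Real orthogonality suffices because the kernel is stable under all scalars. *)
Lemma orthogonal_kerP (x : U) : N x <-> forall v, Q v = 0 -> rip v x = 0.
Proof.
split=> [xN v v0|xN v v0].
  by rewrite (formC (ripS U)) /rip xN// -(real_scalar0 R k) real_scalarK.
rewrite innerC rip_inner_eq0 ?rmorph0; last first.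
  by move=> a; apply: xN; rewrite linearZZ v0 scaler0.
by rewrite -(real_scalar0 R k) real_scalar_conj.
Qed.

Lemma orthogonal_kerPZ (a : R) (x y : realified U) :
  N x -> N y -> N (a *: x + y).
Proof.
move=> /orthogonal_kerP xN /orthogonal_kerP yN; apply/orthogonal_kerP => v v0.
by rewrite (formDr (ripS U)) (formZr (ripS U)) xN// yN// mulr0 addr0.
Qed.

Lemma orthogonal_ker_adjoint (v : V) : N (adjoint Q v).
Proof.
apply/orthogonal_kerP => x x0.
by rewrite -rip_adjoint x0 (form0l (ripS V)).
Qed.

Lemma orthogonal_ker_closed (x : nat -> U) (l : U) :
  (forall i, N (x i)) -> rnorm_cvg x l -> N l.
Proof.
move=> xN xl; apply/orthogonal_kerP => v v0; apply/eqP; apply: contraT => vl.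
have vl0 : 0 < `|rip v l| by rewrite normr_gt0.
have v1 : 0 < rnorm v + 1 by rewrite ltr_wpDl// rnorm_ge0.
have [|n /(_ n (leqnn _))] := xl (`|rip v l| / (rnorm v + 1)).
  by rewrite divr_gt0.
have := normr_rip_le v (x n - l).
have /orthogonal_kerP := xN n => /(_ v v0) xn0.
rewrite (formDr (ripS U)) (formNr (ripS U)) xn0 sub0r normrN ltr_pdivlMr//.
have := rnorm_ge0 (x n - l); lra.
Qed.

(** * Operators bounded below on the orthogonal complement of the kernel *)

Section Coercive.
Variable g : R.
Hypothesis g0 : 0 < g.
Hypothesis gQ : forall x, N x -> g * rnorm x <= rnorm (Q x).

(** Lax-Milgram on [N] gives the equation tested against [N]; the defect is in the range of the
    adjoint, hence in [N], and testing against itself shows that it is zero. *)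
Lemma normal_equation (c : V) : exists2 y, N y & adjoint Q (Q y) = adjoint Q c.
Proof.
pose q (x y : realified U) := rip (Q x) (Q y).
have qS : symmetric_form q.
  split=> [x y|y a x z]; first by rewrite /q (formC (ripS V)).
  by rewrite /q QS (formDl (ripS V)) (formZl (ripS V)).
have fS : scalar (fun x : realified U => rip (Q x) c).
  by move=> a x y; rewrite QS (formDl (ripS V)) (formZl (ripS V)).
pose f : {scalar realified U} := HB.pack (fun x : realified U => rip (Q x) c)
  (GRing.isLinear.Build R (realified U) R _ _ fS).
have [||||||||y yN yP] := @symmetric_lax_milgram R k U N q f
   (g ^+ 2) (op_norm Q ^+ 2) (op_norm Q * rnorm c) qS.
- by apply/orthogonal_kerP => v _; rewrite (form0r (ripS U)).
- by move=> a x y; exact: orthogonal_kerPZ.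
- exact: orthogonal_ker_closed.
- by rewrite exprn_gt0.
- by rewrite sqr_ge0.
- move=> x xN; rewrite /q rip_norm -exprMn lerXn2r// ?nnegrE ?rnorm_ge0//.
    by rewrite mulr_ge0 ?rnorm_ge0// ltW.
  exact: gQ.
- move=> x y; apply: le_trans (normr_rip_le _ _) _.
  have -> : op_norm Q ^+ 2 * rnorm (x : U) * rnorm (y : U) =
    (op_norm Q * rnorm (x : U)) * (op_norm Q * rnorm (y : U)) by ring.
  by rewrite ler_pM ?rnorm_ge0// rnorm_op_le.
- move=> x /=; apply: le_trans (ler_norm _) _.
  apply: le_trans (normr_rip_le _ _) _.
  by rewrite mulrAC ler_wpM2r ?rnorm_ge0// rnorm_op_le.
exists y => //; apply/eqP; rewrite -subr_eq0 -rip_eq0 -adjointB.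
set z := adjoint Q _; apply/eqP; rewrite {2}/z -rip_adjoint.
rewrite (formDr (ripS V)) (formNr (ripS V)).
have /= <- := yP z (orthogonal_ker_adjoint _).
by rewrite /q (formC (ripS V)) subrr.
Qed.

Lemma rnorm_adjoint_ge (x : U) : g * rnorm (Q x) <= rnorm (adjoint Q (Q x)).
Proof.
(* The vector [y] has the same image as [x] but lies in [N], where the lower bound applies. *)
have [y yN yx] := normal_equation (Q x).
have -> : Q x = Q y.
  apply/eqP; rewrite eq_sym -subr_eq0 -rip_eq0 -linearB rip_adjoint linearB.
  by rewrite adjointB yx subrr (form0r (ripS U)).
have [->|Qy0] := eqVneq (Q y) 0.
  by rewrite rnorm0 mulr0 rnorm_ge0.
have nQ0 : 0 < rnorm (Q y) by rewrite rnorm_gt0.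
rewrite -(ler_pM2r nQ0) -mulrA -expr2 -rip_norm rip_adjoint.
apply: le_trans (_ : g * (rnorm y * rnorm (adjoint Q (Q y))) <= _).
  by rewrite ler_pM2l// (le_trans (ler_norm _))// normr_rip_le.
by rewrite mulrA mulrC ler_wpM2l ?rnorm_ge0// gQ.
Qed.

Lemma affine_proj_least_squares (w : V) (u0 : U) :
  let P := affine_proj (least_squares_set Q w) u0 in
  adjoint Q (Q P - w) = 0 /\ N (u0 - P).
Proof.
have [y yN yP] := normal_equation (Q u0 - w).
(* This is the projection: by Pythagoras the least-squares solutions are the [v] with [Q v = Q z], a
   translate of the kernel, and [u0 - z = y] is orthogonal to the kernel. *)
pose z := u0 - y.
have z_eq : adjoint Q (Q z - w) = 0.
  by rewrite /z linearB addrAC adjointB yP subrr.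
have pyth v :
    rnorm (Q v - w) ^+ 2 = rnorm (Q (v - z)) ^+ 2 + rnorm (Q z - w) ^+ 2.
  have -> : Q v - w = Q (v - z) + (Q z - w) by rewrite linearB addrA subrK.
  have : rip (Q (v - z)) (Q z - w) = 0.
    by rewrite rip_adjoint z_eq (form0r (ripS U)).
  move: (Q (v - z)) (Q z - w) => a b ab.
  rewrite -!rip_norm !(formDl (ripS V), formDr (ripS V)) (formC (ripS V) b a).
  by rewrite ab addr0 add0r.
have z_le v : rnorm (Q z - w) <= rnorm (Q v - w).
  rewrite -(@ler_pXn2r _ 2)// ?nnegrE ?rnorm_ge0// (pyth v).
  by rewrite lerDr sqr_ge0.
have infE : inf [set rnorm (Q v - w) | v in [set: U]] = rnorm (Q z - w).
  apply/eqP; rewrite eq_le; apply/andP; split.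
    by apply: ge_inf; [exists (rnorm (Q z - w)) => _ [v _ <-] | exists z].
  by apply: lb_le_inf; [exists (rnorm (Q z - w)), z | move=> _ [v _ <-]].
have lsqP v : least_squares_set Q w v <-> Q v = Q z.
  rewrite /least_squares_set /= infE; split=> [e|->//].
  have := pyth v; rewrite e => /eqP; rewrite eq_sym -subr_eq0 addrK sqrf_eq0.
  by rewrite rnorm_eq0 linearB subr_eq0 => /eqP.
move=> P.
have [PM Porth] : least_squares_set Q w P /\
    forall v, least_squares_set Q w v -> inner U (u0 - P) (v - P) = 0.
  apply: (@xgetPex _ 0 [set v | least_squares_set Q w v /\
    forall y, least_squares_set Q w y -> inner U (u0 - v) (y - v) = 0]).
  exists z; split=> [|v /lsqP vz]; first exact/lsqP.
  have -> : u0 - z = y by rewrite /z opprB addrC subrK.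
  by apply: yN; rewrite /ker_op /= linearB vz subrr.
have QP := (lsqP P).1 PM; split; first by rewrite QP.
move=> v v0; rewrite -[v](addrK P); apply: Porth.
by apply/lsqP; rewrite linearD v0 add0r.
Qed.

(** * The iteration in Hilbert space *)

Section Iteration.
Variables (w : V) (u r p : nat -> U) (P : U).
Hypothesis cg : cg_sequence Q w u r p.
Hypotheses (P_eq : adjoint Q (Q P - w) = 0) (e0_orth : N (u 0 - P)).

Let e m := u m - P.

Definition normal_op (x : realified U) : realified U := adjoint Q (Q x).

Lemma normal_op_linear : linear normal_op.
Proof. by move=> a x y; rewrite /normal_op QS adjoint_linear. Qed.

Let A : {linear realified U -> realified U} :=
  HB.pack normal_op
    (GRing.isLinear.Build R (realified U) (realified U) _ _ normal_op_linear).

Lemma cg_stopped m n : (m <= n)%N -> r m = 0 -> r n = 0 /\ u n = u m.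
Proof.
move=> + rm; elim: n => [|n IH]; first by rewrite leqn0 => /eqP <-.
rewrite leq_eqVlt => /predU1P[<-//|/IH[rn un]].
by have [-> ->] := cg_stop cg rn; rewrite rn un.
Qed.

(** The step sizes are real, so the recurrence lives in the realified space. *)
Lemma cg_alphaE n : cg_alpha Q r p n =
  real_scalar k (rip (r n) (r n) / rip (A (p n)) (p n)).
Proof.
rewrite (formC (ripS U)) -rip_adjoint !rip_norm real_scalarM real_scalarV.
by rewrite !real_scalarX !real_scalar_rnorm.
Qed.

Lemma cg_betaE n : cg_beta r n =
  real_scalar k (rip (r n.+1) (r n.+1) / rip (r n) (r n)).
Proof.
by rewrite !rip_norm real_scalarM real_scalarV !real_scalarX !real_scalar_rnorm.
Qed.

Lemma cg_residualE n : r n = A (e n).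
Proof.
elim: n => [|n IH].
  rewrite (cg_init_r cg); apply/eqP.
  rewrite -subr_eq0 -[A _]/(adjoint Q (Q (u 0 - P))) -adjointB linearB.
  by rewrite opprB addrC addrA subrK P_eq.
have [rn0|rn0] := eqVneq (r n) 0.
  by have [un ->] := cg_stop cg rn0; rewrite IH /e un.
rewrite (cg_step_r cg rn0) /e (cg_step_u cg rn0) cg_alphaE.
rewrite -!realified_scaleE addrAC addrC -/(e n) IH.
by rewrite -[RHS]/(normal_op _) normal_op_linear addrC.
Qed.

Lemma cg_error_orthogonal n : N (e n).
Proof.
have NN (x : U) : N x -> N (- x).
  move=> /orthogonal_kerP xN; apply/orthogonal_kerP => v v0.
  by rewrite (formNr (ripS U)) xN// oppr0.
have rN m : N (r m) by rewrite cg_residualE; exact: orthogonal_ker_adjoint.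
(* Directions are unconstrained after termination, hence the disjunction. *)
suff [] : N (e n) /\ (r n = 0 \/ N (p n)) by [].
elim: n => [|n [en rpn]].
  by split=> //; right; rewrite -[p 0%N]opprK (cg_init_p cg); exact: NN.
have [rn0|rn0] := eqVneq (r n) 0.
  by have [un ->] := cg_stop cg rn0; rewrite /e un; split=> //; left.
have {}rpn : N (p n) by case: rpn rn0 => // ->; rewrite eqxx.
split.
  rewrite /e (cg_step_u cg rn0) cg_alphaE -realified_scaleE addrAC addrC.
  exact: orthogonal_kerPZ.
right; rewrite (cg_step_p cg rn0) cg_betaE -realified_scaleE addrC.
by apply: orthogonal_kerPZ => //; exact: NN.
Qed.

(** Passing from the energy to the norm costs [g] on the left and [op_norm Q] on the right, whence
    the factor [kappa] in front. *)
Lemma cg_error_le n : g <= op_norm Q ->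
  g * (op_norm Q + g) ^+ n * rnorm (e n)
    <= 2 * op_norm Q * (op_norm Q - g) ^+ n * rnorm (e 0).
Proof.
move=> gL; set L := op_norm Q in gL *.
have Lg : 0 <= L - g by rewrite subr_ge0.
have L0 : 0 <= L by exact: op_norm_ge0.
have Lg' : 0 <= L + g by rewrite addr_ge0// ltW.
(* A vanishing residual means a vanishing error, as [A] is injective on [N]. *)
have [rn0|rn0] := eqVneq (r n) 0.
  have -> : e n = 0.
    apply/eqP; rewrite -rnorm_eq0 eq_le rnorm_ge0 andbT -(ler_pM2l g0) mulr0.
    apply: le_trans (gQ (cg_error_orthogonal n)) _.
    have := rnorm_adjoint_ge (e n); rewrite -[adjoint Q _]/(A (e n)).
    by rewrite -cg_residualE rn0 rnorm0 pmulr_rle0.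
  by rewrite rnorm0 mulr0 !mulr_ge0 ?exprn_ge0 ?rnorm_ge0.
have r_neq0 m : (m <= n)%N -> r m != 0.
  by move=> mn; apply: contra_neq rn0 => /(cg_stopped mn)[].
have AC x y : rip (A x) y = rip x (A y).
  by rewrite -[A x]/(adjoint Q (Q x)) -[A y]/(adjoint Q (Q y))
    -rip_adjoint (formC (ripS U)) -rip_adjoint (formC (ripS V)).
have AE x : rip (A x) x = rnorm (Q x) ^+ 2.
  by rewrite AC -rip_adjoint rip_norm.
have A_ge0 x : 0 <= rip (A x) x by rewrite AE sqr_ge0.
have p0 : p 0%N = - A (e 0) :> realified U.
  by rewrite -cg_residualE -(cg_init_p cg) opprK.
have Ae_neq0 m : (m < n)%N -> rip (A (e m)) (A (e m)) != 0.
  by move=> mn; rewrite rip_eq0 -cg_residualE r_neq0// ltnW.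
have eS m : (m < n)%N -> e m.+1 =
    e m + (rip (A (e m)) (A (e m)) / rip (A (p m)) (p m)) *:
      (p m : realified U).
  move=> mn; rewrite /e (cg_step_u cg (r_neq0 _ (ltnW mn))) cg_alphaE.
  by rewrite -realified_scaleE cg_residualE addrAC.
have pS m : (m < n)%N -> p m.+1 = - A (e m.+1) +
    (rip (A (e m.+1)) (A (e m.+1)) / rip (A (e m)) (A (e m))) *:
      (p m : realified U).
  move=> mn; rewrite (cg_step_p cg (r_neq0 _ (ltnW mn))) cg_betaE.
  by rewrite -realified_scaleE !cg_residualE.
have bounds x :
    g ^+ 2 * rip (A x) x <= rip (A (A x)) x <= L ^+ 2 * rip (A x) x.
  have -> : rip (A (A x)) x = rnorm (A x : U) ^+ 2 by rewrite AC rip_norm.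
  rewrite AE -!exprMn !lerXn2r ?nnegrE ?mulr_ge0 ?rnorm_ge0//.
  - exact: rnorm_adjoint_le.
  - exact: ltW.
  - exact: rnorm_adjoint_ge.
have := cg_energy_le (ripS U) AC A_ge0 p0 Ae_neq0 eS pS g0 gL bounds.
rewrite !AE -exprMn -[4]/(2 * 2)%:R natrM -expr2 -!exprMn.
rewrite ler_pXn2r// ?nnegrE ?mulr_ge0 ?exprn_ge0 ?rnorm_ge0//.
move=> h; rewrite -mulrA mulrCA.
apply: le_trans (ler_wpM2l _ (gQ (cg_error_orthogonal n))) _.
  by rewrite exprn_ge0.
apply: le_trans h _.
rewrite -!mulrA ler_pM2l// mulrCA ler_wpM2l ?exprn_ge0//.
exact: rnorm_op_le.
Qed.

End Iteration.

End Coercive.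

(** The modulus may be infinite, so it is accessed through real lower bounds. *)
Lemma reduced_min_modulus_le (g : R) (x : U) :
  (g%:E <= reduced_min_modulus Q)%E -> N x -> g * rnorm x <= rnorm (Q x).
Proof.
move=> gQ xN; have [->|x0] := eqVneq x 0.
  by rewrite linear0 !rnorm0 mulr0.
have nx0 : 0 < rnorm x by rewrite rnorm_gt0.
rewrite -ler_pdivlMr// mulrC -[(rnorm x)^-1]ger0_norm ?invr_ge0 ?rnorm_ge0//.
rewrite -rnormZ realified_scaleE -linearZZ -lee_fin; apply: le_trans gQ _.
apply: ereal_inf_lbound.
exists (real_scalar k (rnorm x)^-1 *: x) => //; split=> /=.
  rewrite -realified_scaleE -[_ *: _]addr0; apply: orthogonal_kerPZ => //.
  by apply/orthogonal_kerP => v _; rewrite (form0r (ripS U)).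
rewrite -realified_scaleE rnormZ ger0_norm ?invr_ge0 ?rnorm_ge0//.
by rewrite mulVf// gt_eqF.
Qed.

End Operator.

Theorem corollary7p6 (R : realType) (k : scalars) (U V : hilbertSpace R k)
    (Q : {linear U -> V}) (boundedQ : bounded_operator Q)
    (gammaQ : (0 < reduced_min_modulus Q)%E)
    (w : V) (u r p : nat -> U) (cg : cg_sequence Q w u r p) (n : nat) :
  let e m := u m - affine_proj (least_squares_set Q w) (u 0%N) in
  let kappa := cond_number Q in
  rnorm (e n) <= 2 * kappa * (1 - 2 / (kappa + 1)) ^+ n * rnorm (e 0%N).
Proof.
pose P := affine_proj (least_squares_set Q w) (u 0%N).
pose e m := u m - P; pose kappa := cond_number Q.
change (rnorm (e n) <=
  2 * kappa * (1 - 2 / (kappa + 1)) ^+ n * rnorm (e 0%N)).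
have [g g0 gQ] : exists2 g : R, 0 < g & (g%:E <= reduced_min_modulus Q)%E.
  case: (reduced_min_modulus Q) gammaQ => [g|_|//].
    by rewrite lte_fin => g0; exists g.
  by exists 1; rewrite ?leey.
have [P_eq e0_orth] := affine_proj_least_squares boundedQ g0
  (fun x => reduced_min_modulus_le gQ) w (u 0%N).
(* This case includes [Q = 0], where [kappa] is [0] by convention; the iteration never moves. *)
have [e0|e0] := eqVneq (e 0%N) 0.
  have r0 : r 0%N = 0.
    by rewrite (cg_residualE boundedQ cg P_eq) -/P -/(e 0%N) e0 linear0.
  have [_ un] := cg_stopped cg (leq0n n) r0.
  by rewrite /e un -/(e 0%N) e0 rnorm0 mulr0.
have ne0 : 0 < rnorm (e 0%N) by rewrite rnorm_gt0.
have [h hE] : exists h, reduced_min_modulus Q = h%:E.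
  have : (reduced_min_modulus Q < +oo)%E.
    rewrite ltNge leye_eq; apply/negP => /eqP gy.
    (* A nonzero [e 0] in the complement of the kernel excludes an infinite modulus: this [a]
       exceeds the ratio attained there. *)
    pose a := rnorm (Q (e 0%N)) / rnorm (e 0%N) + 1.
    have := @reduced_min_modulus_le _ _ _ _ Q a _ _ e0_orth.
    rewrite gy leey => /(_ isT).
    by rewrite -ler_pdivlMr// /a gerDl ler10.
  by case: (reduced_min_modulus Q) gammaQ => // h _ _; exists h.
have h0 : 0 < h by rewrite -lte_fin -hE.
have hQ x : orthogonal_compl (ker_op Q) x -> h * rnorm x <= rnorm (Q x).
  by apply: reduced_min_modulus_le; rewrite hE.
have hL : h <= op_norm Q.
  rewrite -(ler_pM2r ne0); apply: le_trans (hQ _ e0_orth) _.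
  exact: rnorm_op_le.
have := cg_error_le boundedQ h0 hQ cg P_eq e0_orth n hL.
have -> : kappa = op_norm Q / h.
  by rewrite /kappa /cond_number hE inver gt_eqF.
rewrite -/(e n) -/(e 0%N); set L := op_norm Q in hL *.
have L0 : 0 < L by exact: lt_le_trans hL.
have Lh : 0 < L + h by exact: addr_gt0.
have -> : 1 - 2 / (L / h + 1) = (L - h) / (L + h).
  by field; rewrite !gt_eqF.
rewrite expr_div_n => le.
rewrite -(@ler_pM2l _ (h * (L + h) ^+ n)) ?mulr_gt0 ?exprn_gt0//.
apply: le_trans le _; rewrite le_eqVlt; apply/orP; left; apply/eqP.
by field; rewrite !gt_eqF ?exprn_gt0.
Qed.
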